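(* Let $\Theta=(\alpha,\beta,\gamma)\in S_n^3$ be an autotopism of at least one Latin square of order $n$, and suppose each of $\alpha,\beta,\gamma$ has at least one fixed point. Let $z_{11}$ denote the number of fixed points of $\alpha$, let $\alpha_\infty,\beta_\infty$ be the sets of fixed points of $\alpha,\beta$, and let $S=\alpha_\infty\times\beta_\infty\subseteq[n]^2$. Let $S_{RC}=\{P\in C_\Theta:\{(r,c):(r,c,s)\in O(P)\}=S\}$. Then $S_{RC}$ is a homogeneous basis of $\mathcal{LS}_\Theta$, and $|S_{RC}|$ equals the number of Latin squares of order $z_{11}$.
   Context: A Latin square of order $n$ is an $n\times n$ array over $[n]$ with each symbol exactly once in each row and column; a partial Latin square of order $n$ is an $n\times n$ array whose cells are empty or contain a symbol of $[n]$, each symbol at most once per row and column (non-empty: some cell filled). $O(P)$ is the set of (row, column, symbol) triples of filled cells. $\Theta=(\alpha,\beta,\gamma)$ is an autotopism of $P$ if $\{(\alpha(r),\beta(c),\gamma(s)):(r,c,s)\in O(P)\}=O(P)$. $\mathcal{LS}_\Theta$ is the set of Latin squares of order $n$ having $\Theta$ as autotopism; $\mathcal{LS}_{\Theta,P}=\{L\in\mathcal{LS}_\Theta:O(P)\subseteq O(L)\}$. A non-empty partial Latin square $P$ with autotopism $\Theta$ is $\Theta$-completable if $\mathcal{LS}_{\Theta,P}\ne\emptyset$; $C_\Theta$ is the set of such. A set $\{P_1,\dots,P_m\}$ of $\Theta$-completable partial Latin squares is a basis of $\mathcal{LS}_\Theta$ if $\bigcup_i\mathcal{LS}_{\Theta,P_i}=\mathcal{LS}_\Theta$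 and the $\mathcal{LS}_{\Theta,P_i}$ are pairwise disjoint; it is homogeneous if moreover $|\mathcal{LS}_{\Theta,P_i}|=|\mathcal{LS}_{\Theta,P_j}|$ for all $i,j$. *)

(* Defs.v *)
From mathcomp Require Import all_boot all_fingroup matrix.

Set Implicit Arguments.
Unset Strict Implicit.
Unset Printing Implicit Defensive.

(* The set [n] of rows, columns and symbols is 'I_n, numbered from 0. A Latin
   square is an array of symbols, whereas a partial Latin square is an array
   whose empty cells hold None. *)

Definition is_latin (n : nat) (L : 'M['I_n]_n) : bool :=
  [forall r, forall s, #|[set c | L r c == s]| == 1]
  && [forall c, forall s, #|[set r | L r c == s]| == 1].

Definition latin_squares (n : nat) : {set 'M['I_n]_n} :=
  [set L | is_latin L].

Definition is_partial_latin (n : nat) (P : 'M[option 'I_n]_n) : bool :=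
  [forall r, forall s, #|[set c | P r c == Some s]| <= 1]
  && [forall c, forall s, #|[set r | P r c == Some s]| <= 1].

Definition as_partial (n : nat) (L : 'M['I_n]_n) : 'M[option 'I_n]_n :=
  map_mx Some L.

(* O(P); a triple (r, c, s) is ((r, c), s), so t.1 is its cell. *)
Definition entries (n : nat) (P : 'M[option 'I_n]_n)
    : {set 'I_n * 'I_n * 'I_n} :=
  [set t | P t.1.1 t.1.2 == Some t.2].

Definition filled_cells (n : nat) (P : 'M[option 'I_n]_n)
    : {set 'I_n * 'I_n} :=
  [set t.1 | t in entries P].

Definition isotopism (n : nat) : Type := ('S_n * 'S_n * 'S_n)%type.

Definition isotopism_act (n : nat) (Theta : isotopism n)
    (t : 'I_n * 'I_n * 'I_n) : 'I_n * 'I_n * 'I_n :=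
  let: (alpha, beta, gamma) := Theta in
  let: (r, c, s) := t in
  (alpha r, beta c, gamma s).

Definition is_autotopism (n : nat) (Theta : isotopism n)
    (P : 'M[option 'I_n]_n) : bool :=
  [set isotopism_act Theta t | t in entries P] == entries P.

(* LS_Theta *)
Definition LS (n : nat) (Theta : isotopism n) : {set 'M['I_n]_n} :=
  [set L in latin_squares n | is_autotopism Theta (as_partial L)].

(* LS_{Theta,P} *)
Definition LS_containing (n : nat) (Theta : isotopism n)
    (P : 'M[option 'I_n]_n) : {set 'M['I_n]_n} :=
  [set L in LS Theta | entries P \subset entries (as_partial L)].

(* C_Theta *)
Definition completable (n : nat) (Theta : isotopism n)
    : {set 'M[option 'I_n]_n} :=
  [set P | [&& is_partial_latin P, entries P != set0, is_autotopism Theta P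
             & LS_containing Theta P != set0]].

(* Disjointness is required of distinct P and Q, not of distinct values of
   LS_containing Theta, so trivIset of the image would be too weak. *)
Definition is_basis (n : nat) (Theta : isotopism n)
    (B : {set 'M[option 'I_n]_n}) : Prop :=
  [/\ B \subset completable Theta,
      \bigcup_(P in B) LS_containing Theta P = LS Theta
    & {in B &, forall P Q, P != Q ->
         [disjoint LS_containing Theta P & LS_containing Theta Q]}].

Definition is_homogeneous_basis (n : nat) (Theta : isotopism n)
    (B : {set 'M[option 'I_n]_n}) : Prop :=
  is_basis Theta B
  /\ {in B &, forall P Q,
        #|LS_containing Theta P| = #|LS_containing Theta Q|}.

Definition fixed_points (n : nat) (sigma : 'S_n) : {set 'I_n} :=
  [set x | sigma x == x].

Definition S_RC (n : nat) (alpha beta gamma : 'S_n)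
    : {set 'M[option 'I_n]_n} :=
  [set P in completable (alpha, beta, gamma)
     | filled_cells P == setX (fixed_points alpha) (fixed_points beta)].

(* Main.v *)
Require Import Defs.
From mathcomp Require Import all_boot all_fingroup matrix.

(** A Latin square [L] has the autotopism [(alpha, beta, gamma)] iff
    [L (alpha r) (beta c) = gamma (L r c)] for all [r] and [c]. Hence, for an
    entry [(r, c, s)] of [L], if two of [r], [c], [s] are fixed then so is the
    third. The cells in [S] therefore form a subsquare of [L], on the symbols
    fixed by [gamma], and replacing it by any other Latin square on the same
    symbols again gives a square with autotopism [(alpha, beta, gamma)]. *)

Set Implicit Arguments.
Unset Strict Implicit.
Unset Printing Implicit Defensive.

(** * Latin squares and autotopisms in terms of injectivity and entries *)

Lemma card_fibers_eq1P (T : finType) (f : T -> T) :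
  reflect (injective f) [forall s, #|[set x | f x == s]| == 1].
Proof.
apply: (iffP forallP) => [f1 x y fxy | f_inj s].
  have /cards1P[z fz] := f1 (f y).
  have: x \in [set z] by rewrite -fz inE fxy.
  have: y \in [set z] by rewrite -fz inE.
  by rewrite !inE => /eqP-> /eqP->.
(* An injective self-map of a finite type is onto, so no fibre is empty. *)
have -> : [set x | f x == s] = [set invF f_inj s].
  by apply/setP=> x; rewrite !inE -[x in RHS](invF_f f_inj) (can_eq (f_invF _)).
by rewrite cards1.
Qed.

Lemma is_latinP (n : nat) (L : 'M['I_n]_n) :
  reflect ((forall r, injective (L r)) /\ (forall c, injective (L^~ c)))
          (is_latin L).
Proof.
apply: (iffP andP) => -[/= rows cols].
  split=> [r | c]; apply/card_fibers_eq1P.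
    exact: (forallP rows r).
  exact: (forallP cols c).
split; apply/forallP=> x; apply/card_fibers_eq1P; first exact: rows.
exact: cols.
Qed.

Lemma card_some_fibers_le1P (T U : finType) (f : T -> option U) :
  reflect (forall x y s, f x = Some s -> f y = Some s -> x = y)
          [forall s, #|[set x | f x == Some s]| <= 1].
Proof.
apply: (iffP forallP) => [f1 x y s fx fy | f_inj s].
  by apply: (card_le1_eqP (f1 s)); rewrite inE ?fx ?fy.
by apply/card_le1_eqP=> x y; rewrite !inE => /eqP fx /eqP fy; exact: f_inj fy fx.
Qed.

Lemma is_partial_latinP (n : nat) (P : 'M[option 'I_n]_n) :
  reflect ((forall r c c' s, P r c = Some s -> P r c' = Some s -> c = c')
           /\ (forall c r r' s, P r c = Some s -> P r' c = Some s -> r = r'))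
          (is_partial_latin P).
Proof.
apply: (iffP andP) => -[rows cols].
  split=> [r | c].
    exact/card_some_fibers_le1P/(forallP rows r).
  exact/(@card_some_fibers_le1P _ _ (P^~ c))/(forallP cols c).
split; apply/forallP=> x; apply/card_some_fibers_le1P; first exact: rows.
exact: cols.
Qed.

Lemma isotopism_act_inj (n : nat) (Theta : isotopism n) :
  injective (isotopism_act Theta).
Proof.
case: Theta => [[a b] g] [[r c] s] [[r' c'] s'] [].
by move=> /perm_inj-> /perm_inj-> /perm_inj->.
Qed.

Lemma is_autotopismP (n : nat) (alpha beta gamma : 'S_n)
    (P : 'M[option 'I_n]_n) :
  reflect (forall r c s, P r c = Some s ->
             P (alpha r) (beta c) = Some (gamma s))
          (is_autotopism (alpha, beta, gamma) P).
Proof.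
apply: (iffP eqP) => [PE r c s Prc | Pact].
  have: isotopism_act (alpha, beta, gamma) (r, c, s) \in entries P.
    by rewrite -PE imset_f // inE Prc.
  by rewrite inE => /eqP.
(* The isotopism acts injectively on a finite set, so one inclusion already gives equality. *)
apply/eqP; rewrite eqEcard card_imset ?leqnn ?andbT //; last first.
  exact: isotopism_act_inj.
apply/subsetP=> _ /imsetP[[[r c] s] Prc ->]; move: Prc; rewrite !inE /=.
by move=> /eqP/Pact ->.
Qed.

Lemma LSP (n : nat) (alpha beta gamma : 'S_n) (L : 'M['I_n]_n) :
  reflect [/\ forall r, injective (L r), forall c, injective (L^~ c)
            & forall r c, L (alpha r) (beta c) = gamma (L r c)]
          (L \in LS (alpha, beta, gamma)).
Proof.
rewrite !inE; apply: (iffP andP) => [[/is_latinP[rows cols]] | [rows cols act]].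
  move=> /is_autotopismP act; split=> // r c.
  by have := act r c (L r c); rewrite !mxE => /(_ erefl)[].
split; first exact/is_latinP.
by apply/is_autotopismP=> r c s; rewrite !mxE => -[<-]; rewrite act.
Qed.

Lemma LS_containingP (n : nat) (Theta : isotopism n) (P : 'M[option 'I_n]_n)
    (L : 'M['I_n]_n) :
  reflect (L \in LS Theta /\ forall r c s, P r c = Some s -> L r c = s)
          (L \in LS_containing Theta P).
Proof.
rewrite [L \in LS_containing _ _]inE.
apply: (iffP andP) => -[-> sub]; split=> //.
  move=> r c s Prc; have := subsetP sub (r, c, s).
  by rewrite !inE mxE Prc => /(_ (eqxx _))/eqP[].
by apply/subsetP=> -[[r c] s]; rewrite !inE mxE /= => /eqP/sub ->.
Qed.

Lemma filled_cellsE (n : nat) (P : 'M[option 'I_n]_n) (r c : 'I_n) :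
  ((r, c) \in filled_cells P) = (P r c : bool).
Proof.
apply/imsetP/idP => [[[[r' c'] s] Prc [-> ->]] | ].
  by move: Prc; rewrite inE => /eqP ->.
by case Prc: (P r c) => [s|] // _; exists (r, c, s); rewrite // inE Prc.
Qed.

Lemma fixed_pointsP (n : nat) (sigma : 'S_n) (x : 'I_n) :
  reflect (sigma x = x) (x \in fixed_points sigma).
Proof. by rewrite inE; apply: eqP. Qed.

(** Serves to relabel the fixed rows, columns and symbols by a common ordinal type. The element [x0]
    supplies the values of [g] outside [A], so that [g] is total. *)
Lemma set_enumeration (T : finType) (A : {set T}) (x0 : T) (z : nat) :
  x0 \in A -> #|A| = z ->
  exists (f : 'I_z -> T) (g : T -> 'I_z),
    [/\ forall i, f i \in A, cancel f g & {in A, cancel g f}].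
Proof.
move=> Ax0 <-; exists enum_val, (enum_rank_in Ax0).
split=> [i||]; [exact: enum_valP | exact: enum_valK_in | exact: enum_rankK_in].
Qed.

(** * Fixed rows, columns and symbols of a square with the given autotopism *)

Section FixedSubsquare.

Variables (n : nat) (alpha beta gamma : 'S_n).
Implicit Types (L : 'M['I_n]_n) (P Q : 'M[option 'I_n]_n).

Local Notation Theta := (alpha, beta, gamma).
Local Notation A := (fixed_points alpha).
Local Notation B := (fixed_points beta).
Local Notation C := (fixed_points gamma).

Lemma fixed_cell_symbol L r c :
  L \in LS Theta -> r \in A -> c \in B -> L r c \in C.
Proof.
move=> /LSP[_ _ act] /fixed_pointsP ar /fixed_pointsP bc.
by apply/fixed_pointsP; rewrite -act ar bc.
Qed.

(** If [r] and [L r c] are fixed, then [L r (beta c) = gamma (L r c) = L r c], and injectivity of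
    row [r] gives [beta c = c]. *)
Lemma fixed_row_symbol L r c :
  L \in LS Theta -> r \in A -> (L r c \in C) = (c \in B).
Proof.
move=> LSL Ar; apply/idP/idP => [|Bc]; last exact: fixed_cell_symbol.
case/LSP: LSL => rows _ act /fixed_pointsP gs; move/fixed_pointsP: Ar => ar.
by apply/fixed_pointsP/(rows r); rewrite -{1}ar act.
Qed.

Lemma fixed_col_symbol L r c :
  L \in LS Theta -> c \in B -> (L r c \in C) = (r \in A).
Proof.
move=> LSL Bc; apply/idP/idP => [|Ar]; last exact: fixed_cell_symbol.
case/LSP: LSL => _ cols act /fixed_pointsP gs; move/fixed_pointsP: Bc => bc.
by apply/fixed_pointsP/(cols c); rewrite /= -{1}bc act.
Qed.

(** A fixed row is a bijection from columns to symbols, and by [fixed_row_symbol] it carries [B]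
    exactly onto [C]. *)
Lemma card_fixed_cols L r :
  L \in LS Theta -> r \in A -> #|B| = #|C|.
Proof.
move=> LSL Ar; have [rows _ _] := LSP _ _ _ _ LSL.
rewrite -(card_imset _ (rows r)); apply: eq_card => s.
apply/imsetP/idP => [[c Bc ->] | Cs]; first exact: fixed_cell_symbol.
exists (invF (rows r) s); last by rewrite f_invF.
by rewrite -(fixed_row_symbol _ LSL Ar) f_invF.
Qed.

Lemma card_fixed_rows L c :
  L \in LS Theta -> c \in B -> #|A| = #|C|.
Proof.
move=> LSL Bc; have [_ cols _] := LSP _ _ _ _ LSL.
rewrite -(card_imset _ (cols c)); apply: eq_card => s.
apply/imsetP/idP => [[r Ar ->] | Cs]; first exact: fixed_cell_symbol.
have Ls : L (invF (cols c) s) c = s by apply: (f_invF (cols c)).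
by exists (invF (cols c) s); rewrite // -(fixed_col_symbol _ LSL Bc) Ls.
Qed.

(** * Extracting and replacing the fixed subsquare *)

Definition restrict L : 'M[option 'I_n]_n :=
  \matrix_(r, c) if (r \in A) && (c \in B) then Some (L r c) else None.

Definition overlay L P : 'M['I_n]_n := \matrix_(r, c) odflt (L r c) (P r c).

(** A description of the members of [S_RC] that does not mention completions; [S_RC_P] proves the
    equivalence. *)
Definition is_subsquare P : Prop :=
  [/\ is_partial_latin P, forall r c, P r c = (r \in A) && (c \in B) :> bool
    & forall r c s, P r c = Some s -> s \in C].

Lemma subsquare_in P r c :
  is_subsquare P -> r \in A -> c \in B -> exists2 s, P r c = Some s & s \in C.
Proof.
move=> [_ PAB PC] Ar Bc; have := PAB r c; rewrite Ar Bc.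
by case Prc: (P r c) => [s|] // _; exists s; last exact: PC Prc.
Qed.

Lemma subsquare_out P r c :
  is_subsquare P -> ~~ ((r \in A) && (c \in B)) -> P r c = None.
Proof. by move=> [_ PAB _]; rewrite -PAB; case: (P r c). Qed.

(** In a fixed row or column, [L] has symbols of [C] only inside the fixed block, so the symbols of
    [P] cannot clash with those kept from [L]. The autotopism condition is trivial on the block,
    where everything is fixed, and is inherited from [L] off it. *)
Lemma overlay_LS_containing L P :
  L \in LS Theta -> is_subsquare P -> overlay L P \in LS_containing Theta P.
Proof.
move=> LSL sqP; have [/is_partial_latinP[prow pcol] PAB PC] := sqP.
have [rows cols act] := LSP _ _ _ _ LSL.
apply/LS_containingP; split; last by move=> r c s Prc; rewrite mxE Prc.
have rowC r c s c' : P r c = Some s -> P r c' = None -> s <> L r c'.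
  move=> Prc Prc' Es; have := PAB r c; rewrite Prc => /esym/andP[Ar _].
  have := PAB r c'; rewrite Prc' Ar -(fixed_row_symbol c' LSL Ar) -Es.
  by rewrite (PC _ _ _ Prc).
have colC r c s r' : P r c = Some s -> P r' c = None -> s <> L r' c.
  move=> Prc Prc' Es; have := PAB r c; rewrite Prc => /esym/andP[_ Bc].
  have := PAB r' c; rewrite Prc' Bc andbT -(fixed_col_symbol r' LSL Bc) -Es.
  by rewrite (PC _ _ _ Prc).
apply/LSP; split=> [r c c' | c r r' | r c] /=; rewrite !mxE.
- case E: (P r c) => [s|]; case E': (P r c') => [s'|] /=.
  + by move=> Es; apply: prow E _; rewrite E' Es.
  + by move/(rowC _ _ _ _ E E').
  + by move/esym/(rowC _ _ _ _ E' E).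
  + exact: rows.
- case E: (P r c) => [s|]; case E': (P r' c) => [s'|] /=.
  + by move=> Es; apply: pcol E _; rewrite E' Es.
  + by move/(colC _ _ _ _ E E').
  + by move/esym/(colC _ _ _ _ E' E).
  + exact: cols.
have [/andP[Ar Bc] | out] := boolP ((r \in A) && (c \in B)).
  have [s Prc /fixed_pointsP Cs] := subsquare_in sqP Ar Bc.
  by rewrite (fixed_pointsP _ _ Ar) (fixed_pointsP _ _ Bc) Prc /= Cs.
(* The cell [(alpha r, beta c)] is also outside the block, since [alpha (alpha r) = alpha r] iff
   [alpha r = r], and likewise for [beta]. *)
rewrite !(subsquare_out sqP) //= !inE !(inj_eq perm_inj).
by rewrite !inE in out.
Qed.

Lemma restrict_subsquare L : L \in LS Theta -> is_subsquare (restrict L).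
Proof.
move=> LSL; have [rows cols _] := LSP _ _ _ _ LSL; split.
- apply/is_partial_latinP; split=> x y y' s; rewrite !mxE.
    by do 2!case: ifP => // _; move=> [<-] [/rows].
  by do 2!case: ifP => // _; move=> [<-] [/cols].
- by move=> r c; rewrite mxE; case: ifP.
- move=> r c s; rewrite mxE; case: ifP => // /andP[Ar Bc] [<-].
  exact: fixed_cell_symbol.
Qed.

Lemma LS_containing_restrict L P :
  L \in LS_containing Theta P -> is_subsquare P -> P = restrict L.
Proof.
move=> /LS_containingP[_ LP] sqP; apply/matrixP=> r c; rewrite mxE.
case: ifPn => [/andP[Ar Bc] | /(subsquare_out sqP) //].
by have [s Prc _] := subsquare_in sqP Ar Bc; rewrite Prc (LP _ _ _ Prc).
Qed.

Lemma restrict_LS_containing L :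
  L \in LS Theta -> L \in LS_containing Theta (restrict L).
Proof.
move=> LSL; apply/LS_containingP; split=> // r c s.
by rewrite mxE; case: ifP => // _ [].
Qed.

(** Overlaying [Q] loses nothing: squares containing [P] already agree on the block, and off the
    block the overlay keeps their entries. Exchanging [P] and [Q] then gives equal cardinalities. *)
Lemma leq_card_LS_containing P Q :
  is_subsquare P -> is_subsquare Q ->
  #|LS_containing Theta P| <= #|LS_containing Theta Q|.
Proof.
move=> sqP sqQ.
have ov_inj : {in LS_containing Theta P &, injective (overlay^~ Q)}.
  move=> L L' /LS_containingP[_ LP] /LS_containingP[_ LP'] /matrixP LL'.
  apply/matrixP=> r c.
  have [/andP[Ar Bc] | out] := boolP ((r \in A) && (c \in B)).
    have [s Prc _] := subsquare_in sqP Ar Bc.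
    by rewrite (LP _ _ _ Prc) (LP' _ _ _ Prc).
  by have := LL' r c; rewrite !mxE (subsquare_out sqQ out).
rewrite -(card_in_imset ov_inj); apply/subset_leq_card/subsetP=> M.
by case/imsetP=> L /LS_containingP[LSL _] ->; apply: overlay_LS_containing.
Qed.

(** Any completion of [P] has symbols of [C] on the block, hence so does [P]. Conversely, overlaying
    [P] on [L] yields a completion, and the cell [(r0, c0)] makes [P] non-empty. *)
Lemma S_RC_P L r0 c0 P :
  L \in LS Theta -> r0 \in A -> c0 \in B ->
  reflect (is_subsquare P) (P \in S_RC alpha beta gamma).
Proof.
move=> LSL Ar0 Bc0; rewrite !inE.
apply: (iffP andP) => [[/and4P[latP _ _ ] /set0Pn[M LSM] /eqP/setP PAB] | sqP].
  have{} PAB r c : P r c = (r \in A) && (c \in B) :> bool.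
    by rewrite -filled_cellsE PAB in_setX.
  split=> // r c s Prc; move/LS_containingP: LSM => [LSM /(_ _ _ _ Prc) <-].
  have := PAB r c; rewrite Prc => /esym/andP[Ar Bc].
  exact: fixed_cell_symbol.
have [latP PAB PC] := sqP; split; last first.
  by apply/eqP/setP=> -[r c]; rewrite filled_cellsE PAB in_setX.
apply/and4P; split=> //.
- have [s Prc _] := subsquare_in sqP Ar0 Bc0.
  by apply/set0Pn; exists (r0, c0, s); rewrite inE Prc.
- apply/is_autotopismP=> r c s Prc.
  have := PAB r c; rewrite Prc => /esym/andP[/fixed_pointsP-> /fixed_pointsP->].
  by rewrite Prc (fixed_pointsP _ _ (PC _ _ _ Prc)).
- by apply/set0Pn; exists (overlay L P); apply: overlay_LS_containing.
Qed.

(** * The homogeneous basis and its cardinality *)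

Lemma S_RC_homogeneous_basis L r0 c0 :
  L \in LS Theta -> r0 \in A -> c0 \in B ->
  is_homogeneous_basis Theta (S_RC alpha beta gamma).
Proof.
move=> LSL Ar0 Bc0; have srcP P := S_RC_P P LSL Ar0 Bc0.
split; last first.
  move=> P Q /srcP sqP /srcP sqQ.
  by apply/eqP; rewrite eqn_leq !leq_card_LS_containing.
split; first by apply/subsetP=> P; rewrite inE => /andP[].
  apply/setP=> M; apply/bigcupP/idP => [[P _ /LS_containingP[]] // | LSM].
  exists (restrict M); first exact/srcP/restrict_subsquare.
  exact: restrict_LS_containing.
(* A common completion [M] determines both members, each being the restriction of [M]. *)
move=> P Q /srcP sqP /srcP sqQ; apply: contraNT => /pred0Pn[M /andP[MP MQ]].
apply/eqP; rewrite (LS_containing_restrict MP sqP).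
by rewrite -(LS_containing_restrict MQ sqQ).
Qed.

(** Since [A], [B] and [C] have the same size, enumerating them turns Latin squares of order [#|A|]
    into subsquares on the fixed block, bijectively. *)
Lemma card_S_RC L r0 c0 :
  L \in LS Theta -> r0 \in A -> c0 \in B ->
  #|S_RC alpha beta gamma| = #|latin_squares #|A| |.
Proof.
move=> LSL Ar0 Bc0; have srcP P := S_RC_P P LSL Ar0 Bc0.
have AC := card_fixed_rows LSL Bc0.
have BA : #|B| = #|A| by rewrite AC; apply: card_fixed_cols LSL Ar0.
have Cs0 := fixed_cell_symbol LSL Ar0 Bc0.
have [fA [gA [fAA fAK gAK]]] := set_enumeration Ar0 erefl.
have [fB [gB [fBB fBK gBK]]] := set_enumeration Bc0 BA.
have [fC [gC [fCC fCK gCK]]] := set_enumeration Cs0 (esym AC).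
pose phi (M : 'M['I_#|A|]_#|A|) : 'M[option 'I_n]_n :=
  (\matrix_(r, c) if (r \in A) && (c \in B) then Some (fC (M (gA r) (gB c)))
                  else None)%R.
have phi_inj : injective phi.
  move=> M M' /matrixP MM'; apply/matrixP=> i j.
  have := MM' (fA i) (fB j); rewrite !mxE fAA fBB fAK fBK => -[].
  exact: (can_inj fCK).
rewrite -(card_imset _ phi_inj); apply: eq_card => P.
apply/srcP/imsetP => [sqP | [M]]; last first.
  rewrite inE => /is_latinP[rows cols] ->; split.
  - apply/is_partial_latinP; split=> x y y' s; rewrite !mxE.
      case: ifP => // /andP[_ By]; case: ifP => // /andP[_ By'] [<-] [].
      by move=> /(can_inj fCK)/rows/(can_in_inj gBK) ->.
    case: ifP => // /andP[Ay _]; case: ifP => // /andP[Ay' _] [<-] [].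
    by move=> /(can_inj fCK)/cols/(can_in_inj gAK) ->.
  - by move=> r c; rewrite mxE; case: ifP.
  - by move=> r c s; rewrite mxE; case: ifP => // _ [<-].
(* The preimage of [P] is read off through the inverse labelling. The default [L r0 c0] is never
   reached, because every cell [(fA i, fB j)] is filled in [P]. *)
pose M : 'M_#|A| := (\matrix_(i, j) gC (odflt (L r0 c0) (P (fA i) (fB j))))%R.
have [/is_partial_latinP[prow pcol] _ _] := sqP.
have PM i j : P (fA i) (fB j) = Some (fC (M i j)).
  have [s Ps Cs] := subsquare_in sqP (fAA i) (fBB j).
  by rewrite mxE Ps /= gCK.
exists M; last first.
  apply/matrixP=> r c; rewrite mxE; case: ifPn => [/andP[Ar Bc]|].
    by rewrite -PM gAK ?gBK.
  exact: subsquare_out.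
rewrite inE; apply/is_latinP; split=> [i j j' MM | j i i' MM].
  by apply: (can_inj fBK); apply: prow (PM i j) _; rewrite MM.
by apply: (can_inj fAK); apply: pcol (PM i j) _; rewrite MM.
Qed.

End FixedSubsquare.

Theorem theorem20 (n : nat) (alpha beta gamma : 'S_n)
    (hLS : exists L : 'M['I_n]_n, L \in LS (alpha, beta, gamma))
    (halpha : exists r : 'I_n, alpha r = r)
    (hbeta : exists c : 'I_n, beta c = c)
    (hgamma : exists s : 'I_n, gamma s = s) :
  is_homogeneous_basis (alpha, beta, gamma) (S_RC alpha beta gamma)
  /\ #|S_RC alpha beta gamma| = #|latin_squares #|fixed_points alpha| |.
Proof.
have [L LSL] := hLS.
have [r0 /fixed_pointsP Ar0] := halpha; have [c0 /fixed_pointsP Bc0] := hbeta.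
split; first exact: S_RC_homogeneous_basis LSL Ar0 Bc0.
exact: card_S_RC LSL Ar0 Bc0.
Qed.
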